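(* Let $(\hat{\mathcal G}(A,D),p,\mathcal V_a)$ be a sensor network in $\mathbb R^2$ such that the localization problem (Problem 1) is feasible, $\mathcal V_a\cap\mathcal V_A\ne\emptyset$ and $\mathcal V_a\cap\mathcal V_D\neq\emptyset$. Then the sensor network is SA-RoD localizable if and only if the framework $(\hat{\mathcal G}(A,D),p)$ is globally SA-RoD rigid.
   Context: Sensor network: $\mathcal V=\{1,\dots,n\}=\mathcal V_a\cup\mathcal V_f$ (anchors $\mathcal V_a=\{1,\dots,n_a\}$, free nodes $\mathcal V_f=\{n_a+1,\dots,n\}$), $n\ge3$; $\mathcal G=(\mathcal V,\mathcal E)$ is a connected simple undirected graph with a node bipartition $\mathcal V=\mathcal V_A\cup\mathcal V_D$ ($\mathcal V_A,\mathcal V_D$ disjoint and nonempty). The true node locations are $p=(p_1^\top,\dots,p_n^\top)^\top\in\mathbb R^{2n}$ with pairwise distinct $p_i\in\mathbb R^2$. $\hat{\mathcal G}=(\mathcal V,\hat{\mathcal E})$, where $\hat{\mathcal E}$ is $\mathcal E$ together with all edges between pairs of distinct anchors; $\hat{\mathcal G}(A,D)$ carries the same bipartition. $\mathcal T_{\hat A}=\{(u,v,w)\in\mathcal V^3:u\in\mathcal V_A,(u,v),(u,w)\in\hat{\mathcal E},v<w\}$; $\mathcal T_{\hat D}$ likewise with $u\in\mathcal V_D$. For a configuration $x$ with distinct adjacent vertices, $\alpha_{ijk}(x)\in[0,2\pi)$ is the counter-clockwise signed angle from $x_j-x_i$ to $x_k-x_i$, and $\kappa_{ijk}(x)=\|x_k-x_i\|/\|x_j-x_i\|$.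 Measurements: $\theta_{ijk}=\alpha_{ijk}(p)$ for $(i,j,k)\in\mathcal T_{\hat A}$, $\kappa_{rst}=\kappa_{rst}(p)$ for $(r,s,t)\in\mathcal T_{\hat D}$. $\mathcal R(\theta)$ is the counter-clockwise rotation matrix. Problem 1: find $x=(x_1^\top,\dots,x_n^\top)^\top\in\mathbb R^{2n}$ (with $x_i\ne x_j$ for $(i,j)\in\hat{\mathcal E}$) such that $\frac{x_k-x_i}{\|x_k-x_i\|}=\mathcal R(\theta_{ijk})\frac{x_j-x_i}{\|x_j-x_i\|}$ for $(i,j,k)\in\mathcal T_{\hat A}$, $\frac{\|x_t-x_r\|}{\|x_s-x_r\|}=\kappa_{rst}$ for $(r,s,t)\in\mathcal T_{\hat D}$, and $x_i=p_i$ for $i\in\mathcal V_a$. The network is SA-RoD localizable if Problem 1 has a unique feasible solution. For a graph $\mathcal H$ on $\mathcal V$ with the bipartition, $f_{\mathcal H(A,D)}(x)$ is the vector of all $\alpha_{uvw}(x)$ ($u\in\mathcal V_A$) and all $\kappa_{uvw}(x)$ ($u\in\mathcal V_D$) over triplets with $(u,v),(u,w)$ edges of $\mathcal H$, $v<w$; it is defined at every $x$ in which vertices adjacent in $\mathcal H$ are distinct. With $\mathcal K$ the complete graph on $\mathcal V$, $(\mathcal H(A,D),p)$ is globally SA-RoD rigid if $f_{\mathcal H(A,D)}^{-1}(f_{\mathcal H(A,D)}(p))=f_{\mathcal K(A,D)}^{-1}(f_{\mathcal K(A,D)}(p))$. *)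

(* Defs.v *)
From mathcomp Require Import all_boot all_order all_algebra.
From mathcomp Require Import all_classical all_reals all_analysis.

Set Implicit Arguments.
Unset Strict Implicit.
Unset Printing Implicit Defensive.

Import Order.TTheory GRing.Theory Num.Theory.
Local Open Scope ring_scope.

(** A configuration of [n] points of the plane is a matrix [x : 'M[R]_(2, n)];
    the position of node [i] is its [i]-th column. Nodes are numbered from 0. *)

Section Plane.
Variable R : realType.
Implicit Types (u v : 'cV[R]_2) (theta : R).

Definition dot u v : R := \sum_(i < 2) u i 0 * v i 0.

(* The norm [`|u|] of the library is the sup norm on matrices. *)
Definition norm2 u : R := Num.sqrt (dot u u).

Definition dir u : 'cV[R]_2 := (norm2 u)^-1 *: u.

Definition cross u v : R := u 0 0 * v 1 0 - u 1 0 * v 0 0.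

Definition rotation theta : 'M[R]_2 :=
  \matrix_(i < 2, j < 2)
    if i == j then cos theta else if i == 0 then - sin theta else sin theta.

(* The counter-clockwise angle from [u] to [v], in [0, 2 pi[, for nonzero [u]
   and [v]: [acos] gives the unsigned angle in [0, pi], and [cross u v < 0] when
   [v] lies strictly clockwise of [u]. *)
Definition ccw_angle u v : R :=
  let a := acos (dot (dir u) (dir v)) in
  if 0 <= cross u v then a else 2 * pi - a.

End Plane.

Section Configurations.
Variables (R : realType) (n : nat).
Implicit Types (x p : 'M[R]_(2, n)) (H : rel 'I_n) (U A D : {set 'I_n}).

Definition disp x (i j : 'I_n) : 'cV[R]_2 := col j x - col i x.

Definition alpha x (i j k : 'I_n) : R := ccw_angle (disp x i j) (disp x i k).

Definition kappa x (i j k : 'I_n) : R :=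
  norm2 (disp x i k) / norm2 (disp x i j).

Definition triplets H U : {set 'I_n * 'I_n * 'I_n} :=
  [set t | let: (u, v, w) := t in
           [&& u \in U, H u v, H u w & (v < w)%N]]%SET.

(* The domain of the measurement map of the graph [H]. *)
Definition adj_distinct H x : Prop :=
  forall i j : 'I_n, H i j -> col i x <> col j x.

Definition sarod H A D x : 'cV[R]_(#|triplets H A| + #|triplets H D|) :=
  col_mx
    (\col_i let: (u, v, w) := enum_val i in alpha x u v w)
    (\col_i let: (u, v, w) := enum_val i in kappa x u v w).

Definition sarod_fiber H A D p : set 'M[R]_(2, n) :=
  [set x | adj_distinct H x /\ sarod H A D x = sarod H A D p]%classic.

Definition complete_graph : rel 'I_n := fun i j => i != j.

Definition globally_sarod_rigid H A D p : Prop :=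
  sarod_fiber H A D p = sarod_fiber complete_graph A D p.

Definition anchors (na : nat) : {set 'I_n} := [set i : 'I_n | (i < na)%N]%SET.

Definition hat_graph H U : rel 'I_n :=
  fun i j => H i j || [&& i \in U, j \in U & i != j].

(* [x] is a feasible solution of the localization problem on the graph [H]
   with anchor set [U], the measurements being taken at [p]. *)
Definition localization_solution H A D U p x : Prop :=
  [/\ adj_distinct H x,
      forall i j k, (i, j, k) \in triplets H A ->
        dir (disp x i k) = rotation (alpha p i j k) *m dir (disp x i j),
      forall r s t, (r, s, t) \in triplets H D ->
        norm2 (disp x r t) / norm2 (disp x r s) = kappa p r s t
    & forall i, i \in U -> col i x = col i p].

Definition sarod_localizable H A D U p : Prop :=
  exists! x, localization_solution H A D U p x.

End Configurations.

(* Main.v *)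
Require Import Defs.
From mathcomp Require Import all_boot all_order all_algebra.
From mathcomp Require Import all_classical all_reals all_analysis.
From mathcomp Require Import ring lra.

(** Two measurements at an anchor [a] in [A] and an anchor [d] in [D] pin down
    every node [w] adjacent to both, once [a] and [d] are placed: the angle at
    [a] fixes the direction of [w] from [a], the ratio at [d] fixes the distance
    of [w] from [d]; the remaining two-fold ambiguity is removed by the
    measurement at [w] itself, which fixes either the direction of [d] from [w]
    or the distance of [w] from [a].  Since all measurements are invariant under
    orientation-preserving similarities, any configuration with the measurements
    of [p] can be moved so that [a] and [d], hence all anchors, are where [p]
    puts them, and is then a solution of the localization problem. *)

Set Implicit Arguments.
Unset Strict Implicit.
Unset Printing Implicit Defensive.

Import Order.TTheory GRing.Theory Num.Theory.
Local Open Scope ring_scope.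

(** * Euclidean geometry of plane vectors: norms, directions, dot and cross products *)

Section PlaneVectors.
Context {R : realType}.
Implicit Types (u v w : 'cV[R]_2).

Lemma cV2P u v : u 0 0 = v 0 0 -> u 1 0 = v 1 0 -> u = v.
Proof.
move=> h0 h1; apply/matrixP => i j; rewrite (ord1 j).
case: (unliftP 0 i) => [k|] ->; rewrite ?(ord1 k) //.
by move: h1; congr (u _ _ = v _ _); apply/val_inj.
Qed.

Lemma dotE u v : dot u v = u 0 0 * v 0 0 + u 1 0 * v 1 0.
Proof.
rewrite /dot big_ord_recl big_ord1.
by have -> : lift ord0 ord0 = 1 :> 'I_2 by apply/val_inj.
Qed.

Lemma sqr_norm2 u : norm2 u ^+ 2 = dot u u.
Proof. by rewrite sqr_sqrtr // dotE -!expr2 addr_ge0 ?sqr_ge0. Qed.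

Lemma norm2_gt0 u : u != 0 -> 0 < norm2 u.
Proof.
move=> u0; rewrite lt_def sqrtr_ge0 andbT; apply: contraNneq u0 => n0.
have := sqr_norm2 u; rewrite n0 expr0n /= dotE -!expr2 => /esym/eqP.
rewrite paddr_eq0 ?sqr_ge0 // !sqrf_eq0 => /andP[/eqP h0 /eqP h1].
by apply/eqP/cV2P; rewrite mxE.
Qed.

Lemma norm2_neq0 u : u != 0 -> norm2 u != 0.
Proof. by move=> /norm2_gt0; rewrite lt0r => /andP[]. Qed.

Lemma norm2N u : norm2 (- u) = norm2 u.
Proof. by rewrite /norm2; congr Num.sqrt; rewrite !dotE !mxE; ring. Qed.

Lemma dirN u : dir (- u) = - dir u.
Proof. by rewrite /dir norm2N scalerN. Qed.

Lemma dirK u : u != 0 -> norm2 u *: dir u = u.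
Proof. by move=> u0; rewrite scalerA divff ?scale1r ?norm2_neq0. Qed.

Lemma dot_dir u v : dot (dir u) (dir v) = dot u v / (norm2 u * norm2 v).
Proof. by rewrite !dotE !mxE invfM; ring. Qed.

Lemma cross_dir u v : cross (dir u) (dir v) = cross u v / (norm2 u * norm2 v).
Proof. by rewrite /cross !mxE invfM; ring. Qed.

Lemma dot_dir_self u : u != 0 -> dot (dir u) (dir u) = 1.
Proof.
by move=> u0; rewrite dot_dir -sqr_norm2 -expr2 divff // expf_neq0 ?norm2_neq0.
Qed.

Lemma dir_eq u v : u != 0 -> v != 0 ->
  dir u = dir v -> norm2 u = norm2 v -> u = v.
Proof. by move=> u0 v0 duv nuv; rewrite -(dirK u0) -(dirK v0) duv nuv. Qed.

(** Lagrange's identity; for unit vectors it becomes the relation between cosine and sine. *)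
Lemma dot_cross_sqr u v : dot u v ^+ 2 + cross u v ^+ 2 = dot u u * dot v v.
Proof. by rewrite !dotE /cross; ring. Qed.

(** For a unit vector [u], the numbers [dot u v] and [cross u v] are the coordinates of [v] in the
    orthonormal basis formed by [u] and its quarter turn. *)
Lemma dot_cross_inj u v w : dot u u = 1 ->
  dot u v = dot u w -> cross u v = cross u w -> v = w.
Proof.
rewrite !dotE /cross => u1 hd hc.
have decomp x : x = (u 0 0 * u 0 0 + u 1 0 * u 1 0) * x by rewrite u1 mul1r.
apply: cV2P.
  rewrite (decomp (v 0 0)) (decomp (w 0 0)).
  transitivity (u 0 0 * (u 0 0 * v 0 0 + u 1 0 * v 1 0)
                - u 1 0 * (u 0 0 * v 1 0 - u 1 0 * v 0 0)); first by ring.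
  by rewrite hd hc; ring.
rewrite (decomp (v 1 0)) (decomp (w 1 0)).
transitivity (u 1 0 * (u 0 0 * v 0 0 + u 1 0 * v 1 0)
              + u 0 0 * (u 0 0 * v 1 0 - u 1 0 * v 0 0)); first by ring.
by rewrite hd hc; ring.
Qed.

Lemma dir_dot_cross_sqr u v : u != 0 -> v != 0 ->
  dot (dir u) (dir v) ^+ 2 + cross (dir u) (dir v) ^+ 2 = 1.
Proof. by move=> u0 v0; rewrite dot_cross_sqr !dot_dir_self // mulr1. Qed.

Lemma dot_dir_itv u v : u != 0 -> v != 0 ->
  -1 <= dot (dir u) (dir v) <= 1.
Proof.
move=> u0 v0; have := dir_dot_cross_sqr u0 v0.
by move=> h; have := sqr_ge0 (cross (dir u) (dir v)); nra.
Qed.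

Lemma cross_dir_ge0 u v : u != 0 -> v != 0 ->
  (0 <= cross (dir u) (dir v)) = (0 <= cross u v).
Proof.
by move=> u0 v0; rewrite cross_dir pmulr_lge0 // invr_gt0 mulr_gt0 ?norm2_gt0.
Qed.

(** * Oriented angles through their cosine and sine *)

Lemma cos_ccw_angle u v : u != 0 -> v != 0 ->
  cos (ccw_angle u v) = dot (dir u) (dir v).
Proof.
move=> u0 v0; have itv := dot_dir_itv u0 v0; rewrite /ccw_angle.
have ca : cos (acos (dot (dir u) (dir v))) = dot (dir u) (dir v).
  by rewrite acosK.
case: ifP => // _.
by rewrite mulr_natl addrC cosD2pi cosN.
Qed.

(** The sine of an [acos] is nonnegative, so it only yields the absolute value of the cross product;
    the case distinction in [ccw_angle] restores the sign. *)
Lemma sin_ccw_angle u v : u != 0 -> v != 0 ->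
  sin (ccw_angle u v) = cross (dir u) (dir v).
Proof.
move=> u0 v0; have itv := dot_dir_itv u0 v0; rewrite /ccw_angle.
have sa : sin (acos (dot (dir u) (dir v))) = `|cross (dir u) (dir v)|.
  rewrite sin_acos // -sqrtr_sqr; congr Num.sqrt.
  by have := dir_dot_cross_sqr u0 v0 => <-; ring.
rewrite -cross_dir_ge0 //; case: ifPn => [h|]; first by rewrite sa ger0_norm.
rewrite -ltNge => h.
by rewrite mulr_natl addrC sinD2pi sinN sa ltr0_norm ?opprK.
Qed.

(* Unlike equality of [ccw_angle], visibly stable under exchanging the two
   vectors of each pair. *)
Definition same_angle (u v u' v' : 'cV[R]_2) : Prop :=
  dot (dir u) (dir v) = dot (dir u') (dir v') /\
  cross (dir u) (dir v) = cross (dir u') (dir v').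

Lemma same_angleC u v u' v' : same_angle u v u' v' -> same_angle v u v' u'.
Proof.
have dotC a b : dot a b = dot b a :> R by rewrite !dotE; ring.
have crossC a b : cross a b = - cross b a :> R by rewrite /cross; ring.
by move=> [hd hc]; split; [rewrite dotC hd dotC | rewrite crossC hc -crossC].
Qed.

Lemma same_angle_dir u v u' v' : u != 0 -> dir u = dir u' ->
  same_angle u v u' v' -> dir v = dir v'.
Proof.
by move=> u0 duu [+ +]; rewrite -duu; apply: dot_cross_inj; exact: dot_dir_self.
Qed.

(** Cosine and sine of the angle are the dot and cross products of the directions. Conversely
    [ccw_angle] depends only on that dot product and on the sign of the cross product, which
    normalization preserves. *)
Lemma ccw_angle_eq u v u' v' : u != 0 -> v != 0 -> u' != 0 -> v' != 0 ->
  ccw_angle u v = ccw_angle u' v' <-> same_angle u v u' v'.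
Proof.
move=> u0 v0 u'0 v'0; split=> [h | [hd hc]].
  by split; rewrite -?cos_ccw_angle -?sin_ccw_angle // h.
by rewrite /ccw_angle -[0 <= cross u v]cross_dir_ge0 //
  -[0 <= cross u' v']cross_dir_ge0 // hd hc.
Qed.

(** * Rotations and linear similarities of the plane *)

(* Multiplication by the complex number [a + i b] *)
Definition simmx (a b : R) : 'M[R]_2 :=
  \matrix_(i < 2, j < 2) if i == j then a else if i == 0 then - b else b.

Lemma simmxE a b u : (simmx a b *m u) 0 0 = a * u 0 0 - b * u 1 0 /\
  (simmx a b *m u) 1 0 = b * u 0 0 + a * u 1 0.
Proof.
have l1 : lift ord0 ord0 = 1 :> 'I_2 by apply/val_inj.
by split; rewrite !mxE big_ord_recl big_ord1 l1 !mxE //= mulNr.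
Qed.

Lemma rotationE (theta : R) : rotation theta = simmx (cos theta) (sin theta).
Proof. by []. Qed.

Lemma rotation_dir u v u' v' : u != 0 -> v != 0 -> u' != 0 -> v' != 0 ->
  dir v = rotation (ccw_angle u' v') *m dir u <-> same_angle u v u' v'.
Proof.
move=> u0 v0 u'0 v'0; have u1 := dot_dir_self u0.
(* Multiplying the right-hand side by [dot (dir u) (dir u) = 1] turns this claim and the next into
   polynomial identities. *)
have dotR theta : dot (dir u) (rotation theta *m dir u) = cos theta.
  rewrite -[RHS]mulr1 -u1 rotationE !dotE.
  by have [-> ->] := simmxE (cos theta) (sin theta) (dir u); ring.
have crossR theta : cross (dir u) (rotation theta *m dir u) = sin theta.
  rewrite -[RHS]mulr1 -u1 rotationE dotE /cross.
  by have [-> ->] := simmxE (cos theta) (sin theta) (dir u); ring.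
split=> [h | [hd hc]].
  by split; rewrite h ?dotR ?crossR ?cos_ccw_angle ?sin_ccw_angle.
by apply: dot_cross_inj u1 _ _; rewrite ?dotR ?crossR ?cos_ccw_angle ?sin_ccw_angle.
Qed.

Lemma dot_simmx a b u v :
  dot (simmx a b *m u) (simmx a b *m v) = (a ^+ 2 + b ^+ 2) * dot u v.
Proof.
rewrite !dotE; have [-> ->] := simmxE a b u; have [-> ->] := simmxE a b v.
ring.
Qed.

Lemma cross_simmx a b u v :
  cross (simmx a b *m u) (simmx a b *m v) = (a ^+ 2 + b ^+ 2) * cross u v.
Proof.
rewrite /cross; have [-> ->] := simmxE a b u; have [-> ->] := simmxE a b v.
ring.
Qed.

Lemma norm2_simmx a b u :
  norm2 (simmx a b *m u) = Num.sqrt (a ^+ 2 + b ^+ 2) * norm2 u.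
Proof. by rewrite /norm2 dot_simmx sqrtrM // addr_ge0 ?sqr_ge0. Qed.

Lemma simmx_transitive u v : u != 0 -> v != 0 ->
  exists a b : R, 0 < a ^+ 2 + b ^+ 2 /\ simmx a b *m u = v.
Proof.
move=> u0 v0; have n0 : dot u u != 0 by rewrite -sqr_norm2 expf_neq0 ?norm2_neq0.
(* Real and imaginary part of the complex quotient of [v] by [u]. *)
exists (dot u v / dot u u), (cross u v / dot u u).
have h : simmx (dot u v / dot u u) (cross u v / dot u u) *m u = v.
  have [h0 h1] := simmxE (dot u v / dot u u) (cross u v / dot u u) u.
  by move: n0; rewrite !dotE /cross in h0 h1 * => n0; apply: cV2P;
     rewrite ?h0 ?h1; field.
split=> //; rewrite lt_def addr_ge0 ?sqr_ge0 // andbT.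
apply: contraNneq v0 => z.
have := norm2_simmx (dot u v / dot u u) (cross u v / dot u u) u.
rewrite h z sqrtr0 mul0r => nv; apply/negP => /negP /norm2_neq0.
by rewrite nv eqxx.
Qed.

(** Dot and cross products are multiplied by [a ^+ 2 + b ^+ 2], and so is the product of the two
    norms. *)
Lemma same_angle_simmx a b u v : 0 < a ^+ 2 + b ^+ 2 ->
  same_angle (simmx a b *m u) (simmx a b *m v) u v.
Proof.
move=> ab; have s0 : Num.sqrt (a ^+ 2 + b ^+ 2) != 0 by rewrite sqrtr_eq0 -ltNge.
have s2 : Num.sqrt (a ^+ 2 + b ^+ 2) ^+ 2 = a ^+ 2 + b ^+ 2.
  by rewrite sqr_sqrtr // ltW.
by split; rewrite ?dot_dir ?cross_dir ?dot_simmx ?cross_simmx !norm2_simmx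
  mulrACA -expr2 s2 -mulf_div divff ?mul1r // gt_eqF.
Qed.

End PlaneVectors.

(** * Measurements of a configuration and the positions they determine *)

Section Fibers.
Context {R : realType} {n : nat}.
Implicit Types (x y p : 'M[R]_(2, n)) (H : rel 'I_n) (A D : {set 'I_n}).

Lemma disp_eq0 x i j : (disp x i j == 0) = (col i x == col j x).
Proof. by rewrite subr_eq0 eq_sym. Qed.

Lemma dispC x i j : disp x j i = - disp x i j.
Proof. by rewrite /disp opprB. Qed.

Lemma dispB x i j k : disp x j k = disp x i k - disp x i j.
Proof. by rewrite /disp opprB addrA subrK. Qed.

Lemma adj_distinctP H x i j : adj_distinct H x -> H i j -> disp x i j != 0.
Proof. by move=> hx /hx h; rewrite disp_eq0; apply/eqP. Qed.

Lemma sarod_eqP H A D x p : sarod H A D x = sarod H A D p <->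
  (forall u v w, (u, v, w) \in triplets H A -> alpha x u v w = alpha p u v w) /\
  (forall u v w, (u, v, w) \in triplets H D -> kappa x u v w = kappa p u v w).
Proof.
split=> [/eq_col_mx[hA hD]|[hA hD]].
  split=> u v w t; [move: hA|move: hD] => /matrixP/(_ (enum_rank_in t (u, v, w)) 0);
  by rewrite !mxE enum_rankK_in.
congr col_mx; apply/matrixP => i j; rewrite !mxE;
  case: (enum_val i) (enum_valP i) => [[u v] w]; [exact: hA|exact: hD].
Qed.

(* The measurements of [x] and [p] on [H], with no condition on the order of
   the two neighbours. *)
Definition same_measurements H A D x p : Prop :=
  (forall u v w, u \in A -> H u v -> H u w -> v != w ->
     same_angle (disp x u v) (disp x u w) (disp p u v) (disp p u w)) /\
  (forall u v w, u \in D -> H u v -> H u w -> v != w ->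
     kappa x u v w = kappa p u v w).

Lemma mem_triplets H A u v w :
  ((u, v, w) \in triplets H A) = [&& u \in A, H u v, H u w & (v < w)%N].
Proof. by rewrite inE. Qed.

Lemma kappaC x u v w : kappa x u w v = (kappa x u v w)^-1.
Proof. by rewrite /kappa invf_div. Qed.

(** Exchanging the two neighbours reverses the angle and inverts the ratio, so agreement for [v < w]
    gives agreement for [v > w]. *)
Lemma same_measurementsP H A D x p :
  irreflexive H -> adj_distinct H x -> adj_distinct H p ->
  sarod H A D x = sarod H A D p <-> same_measurements H A D x p.
Proof.
move=> Hirr hx hp; rewrite sarod_eqP; split=> -[hA hD]; split=> u v w.
- move=> uA uv uw; rewrite neq_ltn => vw.
  have {}hA a b : H u a -> H u b -> (a < b)%N ->
      same_angle (disp x u a) (disp x u b) (disp p u a) (disp p u b).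
    move=> ua ub ab; apply/ccw_angle_eq;
      rewrite ?(adj_distinctP hx) ?(adj_distinctP hp) //.
    by apply: hA; rewrite mem_triplets uA ua ub.
  by case/orP: vw => vw; [|apply: same_angleC]; apply: hA.
- move=> uD uv uw; rewrite neq_ltn => /orP[] vw; last rewrite kappaC [RHS]kappaC;
  by rewrite hD // mem_triplets uD uv uw.
- rewrite mem_triplets => /and4P[uA uv uw vw].
  apply/ccw_angle_eq; rewrite ?(adj_distinctP hx) ?(adj_distinctP hp) //.
  by apply: hA => //; rewrite neq_ltn vw.
- rewrite mem_triplets => /and4P[uD uv uw vw].
  by apply: hD => //; rewrite neq_ltn vw.
Qed.

(** The rotation equation and the equality of angles both amount to [same_angle]; solutions are thus
    the points of the fiber of [p] that agree with [p] on the anchors. *)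
Lemma localization_solutionP H A D (U : {set 'I_n}) x p :
  adj_distinct H p ->
  localization_solution H A D U p x <->
  [/\ adj_distinct H x, sarod H A D x = sarod H A D p
    & forall i, i \in U -> col i x = col i p].
Proof.
move=> hp; split=> -[hx].
  move=> hA hD hU; split=> //; apply/sarod_eqP; split=> u v w t; last exact: hD.
  have := t; rewrite mem_triplets => /and4P[uA uv uw vw].
  apply/ccw_angle_eq; rewrite ?(adj_distinctP hx) ?(adj_distinctP hp) //.
  by apply/rotation_dir; rewrite ?(adj_distinctP hx) ?(adj_distinctP hp) //; exact: hA.
move=> /sarod_eqP[hA hD] hU; split=> // u v w t.
have := t; rewrite mem_triplets => /and4P[uA uv uw vw].
apply/rotation_dir; rewrite ?(adj_distinctP hx) ?(adj_distinctP hp) //.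
by apply/ccw_angle_eq; rewrite ?(adj_distinctP hx) ?(adj_distinctP hp) //; exact: hA.
Qed.

(** The graph is left general because the result serves twice: on the graph with anchor edges, for
    [w] an anchor, and on the complete graph, for any other node [w]. *)
Lemma position_determined H A D x p a d w :
  symmetric H -> adj_distinct H x -> adj_distinct H p ->
  same_measurements H A D x p ->
  a \in A -> d \in D -> w \in (A :|: D)%SET -> a != d -> w != a -> w != d ->
  H a d -> H a w -> H d w ->
  col a x = col a p -> col d x = col d p -> col w x = col w p.
Proof.
move=> Hsym hx hp [hA hD] aA dD wAD ad wa wd Had Haw Hdw xa xd.
have ead : disp x a d = disp p a d by rewrite /disp xa xd.
have [Hda Hwa Hwd] : [/\ H d a, H w a & H w d] by rewrite !(Hsym _ a) (Hsym w d).
have dirw : dir (disp x a w) = dir (disp p a w).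
  apply: same_angle_dir (hA _ _ _ aA Had Haw _); rewrite ?ead //.
    by rewrite (adj_distinctP hp).
  by rewrite eq_sym.
have normw : norm2 (disp x d w) = norm2 (disp p d w).
  have := hD _ _ _ dD Hda Hdw; rewrite eq_sym => /(_ wa).
  rewrite /kappa !(dispC _ a d) ead => /divIf; apply.
  by rewrite norm2N norm2_neq0 // (adj_distinctP hp).
(* The ray from [a] may still meet the circle around [d] twice. If [w] is in [A], the angle at [w]
   gives the direction of [d] from [w], whose distance is known; if [w] is in [D], the ratio at [w]
   gives the distance along the ray. *)
move: wAD; rewrite inE => /orP[wA|wD].
  have dird : dir (disp x w d) = dir (disp p w d).
    apply: same_angle_dir (hA _ _ _ wA Hwa Hwd ad); first exact: adj_distinctP hx _.
    by rewrite !(dispC _ a w) !dirN dirw.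
  have : disp x w d = disp p w d.
    apply: dir_eq => //; rewrite ?(adj_distinctP hx) ?(adj_distinctP hp) //.
    by rewrite !(dispC _ d w) !norm2N.
  by rewrite /disp xd => /addrI/oppr_inj.
have : disp x a w = disp p a w.
  apply: dir_eq => //; rewrite ?(adj_distinctP hx) ?(adj_distinctP hp) //.
  have := hD _ _ _ wD Hwd Hwa; rewrite eq_sym => /(_ ad).
  rewrite /kappa !(dispC _ d w) !(dispC _ a w) !norm2N normw => /divIf; apply.
  by rewrite norm2_neq0 // (adj_distinctP hp).
by rewrite /disp xa => /addIr.
Qed.

End Fibers.

(** * Localizability against global rigidity *)

Theorem theorem11 (R : realType) (n na : nat) (hn : (3 <= n)%N)
  (hna : (na <= n)%N)
  (E : rel 'I_n) (E_sym : symmetric E) (E_irr : irreflexive E)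
  (E_conn : forall i j : 'I_n, connect E i j)
  (A D : {set 'I_n}) (AD_cover : (A :|: D)%SET = [set: 'I_n]%SET)
  (AD_disj : [disjoint A & D]) (A_neq0 : A <> finset.set0)
  (D_neq0 : D <> finset.set0)
  (p : 'M[R]_(2, n)) (p_inj : injective (fun i : 'I_n => col i p))
  (feasible : exists x : 'M[R]_(2, n),
      localization_solution (hat_graph E (anchors n na)) A D (anchors n na) p x)
  (anchor_A : (anchors n na :&: A)%SET <> finset.set0)
  (anchor_D : (anchors n na :&: D)%SET <> finset.set0) :
  sarod_localizable (hat_graph E (anchors n na)) A D (anchors n na) p <->
  globally_sarod_rigid (hat_graph E (anchors n na)) A D p.
Proof.
set U := anchors n na; set H := hat_graph E U; set K := @complete_graph n.
have [a /setIP[aU aA]] : exists a, a \in (U :&: A)%SET by apply/set0Pn/eqP.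
have [d /setIP[dU dD]] : exists d, d \in (U :&: D)%SET by apply/set0Pn/eqP.
have ad : a != d by apply: contraTneq dD => <-; rewrite (disjointFr AD_disj).
have Hirr : irreflexive H by move=> i; rewrite /H /hat_graph E_irr eqxx !andbF.
have Hsym : symmetric H.
  by move=> i j; rewrite /H /hat_graph E_sym eq_sym andbCA.
have HU i j : i \in U -> j \in U -> i != j -> H i j.
  by move=> iU jU ij; rewrite /H /hat_graph iU jU ij orbT.
have HK i j : H i j -> K i j by apply: contraTneq => ->; rewrite Hirr.
have Kirr : irreflexive K by move=> i; rewrite /K /complete_graph eqxx.
have Ksym : symmetric K by move=> i j; rewrite /K /complete_graph eq_sym.
have Kp : adj_distinct K p by move=> i j /eqP ij /p_inj.
have Hp : adj_distinct H p by move=> i j /HK /Kp.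
have AD w : w \in (A :|: D)%SET by rewrite AD_cover inE.
(* One inclusion between the fibers always holds: every edge of [H] is an edge of [K]. *)
have fiber_KH x : sarod_fiber K A D p x -> sarod_fiber H A D p x.
  move=> [Kx /sarod_eqP[hA hD]]; split; first by move=> i j /HK /Kx.
  by apply/sarod_eqP; split=> u v w; rewrite mem_triplets => /and4P[? /HK uv /HK uw ?];
    [apply: hA | apply: hD]; rewrite mem_triplets; apply/and4P.
have p_sol : localization_solution H A D U p p by apply/localization_solutionP.
split=> [[z [_ z_uniq]] | rigid].
- apply/seteqP; split=> // x [Hx /(same_measurementsP _ _ Hirr Hx Hp) [mA mD]].
  have xad := adj_distinctP Hx (HU _ _ aU dU ad).
  have pad := adj_distinctP Hp (HU _ _ aU dU ad).
  (* The similarity taking [a] and [d] from their places in [x] to those in [p] moves [x] to [y]. *)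
  have [s [t [st Mad]]] := simmx_transitive xad pad.
  pose y := \matrix_(i < 2, j < n) ((simmx s t *m disp x a j) i 0 + p i a).
  have coly j : col j y = simmx s t *m disp x a j + col a p.
    by apply/matrixP => i k; rewrite !mxE (ord1 k).
  have dispy i j : disp y i j = simmx s t *m disp x i j.
    rewrite (dispB x a i j) [RHS]mulmxBr {1}/disp !coly opprD addrACA subrr.
    by rewrite addr0.
  have ya : col a y = col a p by rewrite coly /disp subrr mulmx0 add0r.
  have yd : col d y = col d p by rewrite coly Mad /disp subrK.
  have angle_y i j k :
      same_angle (disp y i j) (disp y i k) (disp x i j) (disp x i k).
    by rewrite !dispy; exact: same_angle_simmx.
  have kappa_y i j k : kappa y i j k = kappa x i j k.
    rewrite /kappa !dispy !norm2_simmx -mulf_div divff ?mul1r //.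
    by rewrite sqrtr_eq0 -ltNge.
  have Hy : adj_distinct H y.
    move=> i j ij /eqP; rewrite -disp_eq0 dispy => /eqP z0.
    have := norm2_simmx s t (disp x i j); rewrite z0.
    have -> : norm2 (0 : 'cV[R]_2) = 0 by rewrite /norm2 dotE !mxE !mul0r addr0 sqrtr0.
    move/esym/eqP; apply/negP; rewrite mulf_neq0 //; first by rewrite sqrtr_eq0 -ltNge.
    by apply/norm2_neq0; exact: adj_distinctP Hx ij.
  have my : same_measurements H A D y p.
    split=> u v w uA uv uw vw; last by rewrite kappa_y mD.
    by rewrite /same_angle; have [-> ->] := angle_y u v w; exact: mA.
  have y_sol : localization_solution H A D U p y.
    apply/localization_solutionP => //; split=> //.
      exact/same_measurementsP.
    (* Anchors are pairwise adjacent in [H], so each remaining one is adjacent to both [a] and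
       [d]. *)
    move=> i iU; have [->//|ia] := eqVneq i a; have [->//|id] := eqVneq i d.
    apply: (position_determined (H := H) (A := A) (D := D) (a := a) (d := d)) => //;
      by apply: HU => //; rewrite eq_sym.
  have yp : y = p by rewrite -(z_uniq _ y_sol) -(z_uniq _ p_sol).
  (* Uniqueness has made [x] a similar copy of [p]: nodes coinciding in [x] would coincide in [p],
     and all angles and ratios agree, along edges of [H] or not. *)
  have Kx : adj_distinct K x.
    by move=> i j ij xij; apply: (Kp i j ij); rewrite -yp !coly /disp xij.
  split=> //; apply/same_measurementsP => //; split=> u v w _ _ _ _; rewrite -yp //.
  by rewrite /same_angle; have [-> ->] := angle_y u v w.
- exists p; split=> // x /localization_solutionP-/(_ Hp)[Hx hx xU].
  (* Rigidity extends the agreement of [x] with [p] to the complete graph, where every other node is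
     adjacent to both [a] and [d]. *)
  have [Kx /(same_measurementsP _ _ Kirr Kx Kp) mx] : sarod_fiber K A D p x.
    by rewrite -rigid.
  suff colx i : col i p = col i x.
    by apply/matrixP => i j; have /matrixP/(_ i 0) := colx j; rewrite !mxE.
  have [->|ia] := eqVneq i a; first by rewrite xU.
  have [->|id] := eqVneq i d; first by rewrite xU.
  by apply/esym/(position_determined (H := K) (A := A) (D := D) (a := a) (d := d));
     rewrite ?xU //;
     rewrite /K /complete_graph // eq_sym.
Qed.
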